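(* Let $p$ be an odd prime, let $d,k\in\mathbb{N}$ with $d\equiv 1 \pmod 2$ and $(p,d)=1$, let $\chi$ be a Dirichlet character with conductor $d$, and let $q\in\mathbb{C}_p$ with $|1-q|_p<1$. Then for every integer $m\ge 0$ and every $x\in\mathbb{Z}_p$, $$\frac{2^k q^{mx}\sum_{a_1, \ldots, a_k=0}^{d-1}\left(\prod_{j=1}^k \chi(a_j) \right)q^{\sum_{j=1}^k(m-j)a_j}(-1)^{\sum_{j=1}^k a_j}}{(-q^{d(m-k)}:q^d)_k} =\sum_{l=0}^m \binom{m}{l}(q-1)^l E_{l,\chi,q}^{(0,k)}(x).$$
   Context: Notation. $\mathbb{Z}_p$, $\mathbb{Q}_p$, $\mathbb{C}_p$ denote the $p$-adic integers, the $p$-adic numbers, and the completion of an algebraic closure of $\mathbb{Q}_p$, with $|p|_p=1/p$. For $q\in\mathbb{C}_p$ with $|1-q|_p<1$, $q^x$ is defined for $x\in\mathbb{Z}_p$, and $[x]_q=\frac{1-q^x}{1-q}$. For $a\in\mathbb{C}_p$, a base $Q$ and $k\in\mathbb{N}$, $(a:Q)_k=(1-a)(1-aQ)\cdots(1-aQ^{k-1})$; thus $(-q^{d(m-k)}:q^d)_k=\prod_{i=0}^{k-1}\bigl(1+q^{d(m-k+i)}\bigr)$. Let $X=\varprojlim_N \mathbb{Z}/dp^N\mathbb{Z}$ (with its natural map to $\mathbb{Z}_p$, so $q^{y}$ and $[y]_q$ make sense for $y\in X$); $\chi$ is regarded as a function on $X$ via reduction modulo $d$. The fermionic $p$-adic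 invariant integral on $X$ of a (uniformly differentiable) function $f:X\to\mathbb{C}_p$ is $$\int_X f(y)\,d\mu(y)=\lim_{N\to\infty}\sum_{j=0}^{dp^N-1} f(j)(-1)^j,$$ and multiple integrals $\int_X\cdots\int_X \,d\mu(x_1)\cdots d\mu(x_k)$ are iterated such integrals. For $h\in\mathbb{Z}$, $k\in\mathbb{N}$, $n\ge 0$ and $x\in\mathbb{Z}_p$, the generalized $q$-Euler polynomials of order $k$ are $$E_{n,\chi,q}^{(h,k)}(x)=\int_X\cdots\int_X q^{\sum_{j=1}^k(h-j)x_j}\Bigl(\prod_{j=1}^k\chi(x_j)\Bigr)\,[x+x_1+\cdots+x_k]_q^n\,d\mu(x_1)\cdots d\mu(x_k).$$ In the theorem $h=0$, i.e. the weight is $q^{-\sum_{j=1}^k j x_j}$. *)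

(* Defs.v *)
From HB Require Import structures.
From mathcomp Require Import all_boot all_order all_algebra.
From mathcomp Require Import all_classical all_reals all_analysis.
Set Implicit Arguments.
Unset Strict Implicit.
Unset Printing Implicit Defensive.
Import Order.TTheory GRing.Theory Num.Theory.
Import numFieldNormedType.Exports.
Local Open Scope classical_set_scope.
Local Open Scope ring_scope.

(* Fields with a real-valued ultrametric absolute value. The library's normed
   structures cannot be used: they require |x *+ n| = |x| *+ n. *)
Record ultrametricField (R : realType) := UltrametricField {
  ultra_car : fieldType ;
  ultra_abs : ultra_car -> R ;
  ultra_abs_ge0 : forall x, 0 <= ultra_abs x ;
  ultra_abs_eq0 : forall x, ultra_abs x = 0 <-> x = 0 ;
  ultra_absM : forall x y, ultra_abs (x * y) = ultra_abs x * ultra_abs y ;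
  ultra_absD : forall x y,
    ultra_abs (x + y) <= Num.max (ultra_abs x) (ultra_abs y) }.

(* The carrier, as a field with the topology and uniformity of the distance
   |x - y|. *)
Definition ultra_sort (R : realType) (K : ultrametricField R) : Type :=
  ultra_car K.
Coercion ultra_sort : ultrametricField >-> Sortclass.

Definition absv (R : realType) (K : ultrametricField R) (x : K) : R :=
  @ultra_abs R K x.

HB.instance Definition _ (R : realType) (K : ultrametricField R) :=
  GRing.Field.copy (ultra_sort K) (ultra_car K).
HB.instance Definition _ (R : realType) (K : ultrametricField R) :=
  isPointed.Build (ultra_sort K) 0.

Section Metric.
Variables (R : realType) (K : ultrametricField R).
Implicit Types x y z : K.

Lemma absv1 : absv (1 : K) = 1.
Proof.
have ne0 : absv (1 : K) != 0.
  by apply/eqP => /(@ultra_abs_eq0 R K 1) /eqP; rewrite oner_eq0.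
by apply: (mulfI ne0); rewrite mulr1 -[LHS]ultra_absM mulr1.
Qed.

Lemma absvN x : absv (- x) = absv x.
Proof.
have absN1 : absv (-1 : K) = 1.
  apply/eqP; rewrite -(@eqrXn2 _ 2) ?ler01 ?ultra_abs_ge0 //.
  by rewrite expr1n expr2 -[_ * _]ultra_absM mulrNN mulr1 [ultra_abs _]absv1.
rewrite -mulN1r [LHS]ultra_absM.
by rewrite -[ultra_abs (-1)]/(absv (-1 : K)) absN1 mul1r.
Qed.

Definition ultra_dist x y : R := absv (x - y).

Lemma ultra_distxx x : ultra_dist x x = 0.
Proof. by apply/(@ultra_abs_eq0 R K); rewrite subrr. Qed.

Lemma ultra_dist_eq0 x y : ultra_dist x y = 0 -> x = y.
Proof. by move/(@ultra_abs_eq0 R K)/eqP; rewrite subr_eq0 => /eqP. Qed.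

Lemma ultra_distC x y : ultra_dist x y = ultra_dist y x.
Proof. by rewrite /ultra_dist -absvN opprB. Qed.

Lemma ultra_dist_triangle y x z :
  ultra_dist x z <= ultra_dist x y + ultra_dist y z.
Proof.
have -> : ultra_dist x z = absv ((x - y) + (y - z)).
  by rewrite /ultra_dist addrA subrK.
apply: (le_trans (@ultra_absD R K _ _)).
by rewrite ge_max lerDl lerDr !ultra_abs_ge0.
Qed.

HB.instance Definition _ := isMetric.Build R (ultra_sort K)
  ultra_distxx ultra_dist_eq0 ultra_distC ultra_dist_triangle.

End Metric.

Section Cp.
Variables (R : realType) (K : ultrametricField R).

(* When K is complete and |p| = 1/p, this is the completion of Q for the p-adic
   absolute value. *)
Definition padicQ : set K := closure (range (ratr : rat -> K)).

Definition padicZ : set K := [set x | padicQ x /\ absv x <= 1].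

Definition padicQbar : set K :=
  [set z | exists f : {poly K}, [/\ f != 0, forall i, padicQ f`_i & root f z]].

(* K is the completion of an algebraic closure of Q_p, with |p| = 1/p. This
   determines K up to isometric isomorphism; ultrametricity and |p| = 1/p force
   |.| to be the p-adic absolute value on Q. The third clause says that the
   algebraic extension padicQbar of Q_p is algebraically closed. *)
Record is_Cp (p : nat) : Prop := IsCp {
  Cp_normp : absv (p%:R : K) = p%:R^-1 ;
  Cp_complete : forall F : set_system K, ProperFilter F -> cauchy F -> cvg F ;
  Cp_closed : forall f : {poly K},
    (forall i, padicQbar f`_i) -> (1 < size f)%N ->
    exists2 z, padicQbar z & root f z ;
  Cp_dense : closure padicQbar = setT }.

(* q^x for |1 - q| < 1 and x in Z_p: the limit of q^n as the natural number n
   tends to x p-adically. *)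
Definition qpow (q x : K) : K :=
  lim ((fun n : nat => q ^+ n) @
    filter_from (nbhs x) (preimage (fun n : nat => n%:R : K))).

(* At q = 1 the quotient is 0/0, and [x]_q is its limit x as q tends to 1. *)
Definition qnum (q x : K) : K :=
  if q == 1 then x else (1 - qpow q x) / (1 - q).

Definition qpoch (a Q : K) (k : nat) : K := \prod_(i < k) (1 - a * Q ^+ i).

End Cp.

(* Elements of the inverse limit of the Z/dp^N: coherent sequences of residues,
   each represented by its remainder in [0, dp^N) (for d, p > 0 the bound
   follows from the coherence condition). *)
Record dpLim (d p : nat) := DpLim {
  res :> nat -> nat ;
  resP : forall N, res N = (res N.+1 %% (d * p ^ N))%N }.

Lemma dpLim_nat_subproof d p (j N : nat) :
  (j %% (d * p ^ N) = (j %% (d * p ^ N.+1)) %% (d * p ^ N))%N.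
Proof. by rewrite modn_dvdm // expnSr mulnA dvdn_mulr. Qed.

Definition dpLim_nat d p (j : nat) : dpLim d p :=
  DpLim (dpLim_nat_subproof d p j).

Section Euler.
Variables (R : realType) (K : ultrametricField R) (d p : nat).
Local Notation X := (dpLim d p).

(* The natural map X -> Z_p, with Z_p seen inside K. *)
Definition toZp (y : X) : K := lim ((fun N => (y N)%:R : K) @ \oo).

Definition fint (f : X -> K) : K :=
  lim ((fun N => \sum_(0 <= j < d * p ^ N) f (dpLim_nat d p j) * (-1) ^+ j)
         @ \oo).

(* Iterated integral; the innermost one is over the first variable. *)
Fixpoint fintn (k : nat) : (k.-tuple X -> K) -> K :=
  match k with
  | 0 => fun f => f [tuple]
  | k'.+1 => fun f => fint (fun y => fintn (fun t => f [tuple of rcons t y]))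
  end.

Definition dirichlet_char (chi : int -> K) : Prop :=
  [/\ chi 1 = 1,
      forall a b, chi (a * b) = chi a * chi b,
      forall a b, (a = b %[mod d])%Z -> chi a = chi b
    & forall a, chi a = 0 <-> ~~ coprimez a d].

(* A character modulo d whose conductor is d: it is not induced from any proper
   divisor of d. *)
Definition primitive_char (chi : int -> K) : Prop :=
  dirichlet_char chi /\
  forall e : nat, (e %| d)%N ->
    (forall a : int, coprimez a d -> (a = 1 %[mod e])%Z -> chi a = 1) -> e = d.

(* Reduction of y : X modulo d is y 0, as d * p ^ 0 = d. *)
Definition char_lim (chi : int -> K) (y : X) : K := chi (y 0)%:Z.

(* The index i : 'I_k stands for j = i + 1. *)
Definition qEuler (chi : int -> K) (q : K) (h : int) (k n : nat) (x : K) : K :=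
  fintn (fun t : k.-tuple X =>
    qpow q (\sum_(i < k) (h - i.+1%:Z)%:~R * toZp (tnth t i))
    * (\prod_(i < k) char_lim chi (tnth t i))
    * qnum q (x + \sum_(i < k) toZp (tnth t i)) ^+ n).

End Euler.

(* Main.v *)
(* Since 1 + (q - 1)[y]_q = q^y, the right-hand side is the integral of
   q^(m(x + x_1 + ... + x_k)) against the weight, i.e. q^(mx) times the product
   over j of the integrals of chi(y) q^((m - j)y).  Splitting 0 <= j < dp^N into
   blocks of length d makes the N-th partial sum of the integral of
   chi(y) q^(ey) equal to
   (1 + q^(edp^N)) / (1 + q^(ed)) * sum_(a < d) chi(a) q^(ea) (-1)^a,
   where d and p odd give the signs, and q^(edp^N) tends to 1.  The denominators
   do not vanish because |q^z - 1| < 1 = |2|.  Each integral samples its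
   integrand at natural numbers only, so the iterated integrals reduce to finite
   linear combinations of products of such one-variable integrals. *)

Require Import Defs.
From HB Require Import structures.
From mathcomp Require Import all_boot all_order all_algebra.
From mathcomp Require Import all_classical all_reals all_analysis.
From mathcomp Require Import ring.
Import Order.TTheory GRing.Theory Num.Theory.
Import numFieldNormedType.Exports.
Local Open Scope ring_scope.
Set Implicit Arguments.
Unset Strict Implicit.
Unset Printing Implicit Defensive.

(** * Ultrametric inequalities; limits and closures expressed through [absv] *)

Section Absv.
Variables (R : realType) (K : ultrametricField R).
Implicit Types (x y z q : K) (n N : nat).

Lemma absv_ge0 x : 0 <= absv x. Proof. exact: ultra_abs_ge0. Qed.

Lemma absv0 : absv (0 : K) = 0. Proof. exact/(@ultra_abs_eq0 R K). Qed.

Lemma absv_eq0 x : (absv x == 0) = (x == 0).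
Proof. by apply/eqP/eqP => /(@ultra_abs_eq0 R K x). Qed.

Lemma absvM x y : absv (x * y) = absv x * absv y.
Proof. exact: ultra_absM. Qed.

Lemma absvX x n : absv (x ^+ n) = absv x ^+ n.
Proof. by elim: n => [|n IH]; rewrite ?expr0 ?absv1 // !exprS absvM IH. Qed.

Lemma absvV x : absv x^-1 = (absv x)^-1.
Proof.
have [->|x0] := eqVneq x 0; first by rewrite invr0 absv0 invr0.
have a0 : absv x != 0 by rewrite absv_eq0.
by apply: (mulfI a0); rewrite -absvM !mulfV ?absv1.
Qed.

Lemma absvC x y : absv (x - y) = absv (y - x).
Proof. exact: ultra_distC. Qed.

Lemma absvD_le c x y : absv x <= c -> absv y <= c -> absv (x + y) <= c.
Proof.
by move=> xc yc; apply: le_trans (ultra_absD x y) _; rewrite ge_max xc.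
Qed.

Lemma absvD_lt c x y : absv x < c -> absv y < c -> absv (x + y) < c.
Proof.
by move=> xc yc; apply: le_lt_trans (ultra_absD x y) _; rewrite gt_max xc.
Qed.

Lemma absvB_lt c y x z :
  absv (x - y) < c -> absv (y - z) < c -> absv (x - z) < c.
Proof. by move=> xy yz; rewrite -(subrK y x) -addrA absvD_lt. Qed.

Lemma absv_sum_le c (I : Type) (r : seq I) (P : pred I) (F : I -> K) :
  0 <= c -> (forall i, P i -> absv (F i) <= c) ->
  absv (\sum_(i <- r | P i) F i) <= c.
Proof.
move=> c0 Fc; elim/big_rec: _ => [|i y Pi yc]; first by rewrite absv0.
by rewrite absvD_le ?Fc.
Qed.

(** If [absv x < 1] held as well, [1 = (1 - x) + x] would have absolute value below 1. *)
Lemma absv_near1 x : absv (1 - x) < 1 -> absv x = 1.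
Proof.
move=> x1; apply/eqP; rewrite eq_le; apply/andP; split.
  rewrite -[x](subKr 1) absvD_le ?absv1 // absvN; exact: ltW.
rewrite leNgt; apply/negP => xlt.
by have := absvD_lt x1 xlt; rewrite subrK absv1 ltxx.
Qed.

Lemma absv_nat_le1 n : absv (n%:R : K) <= 1.
Proof.
elim: n => [|n IH]; first by rewrite absv0 ler01.
by rewrite -natr1 absvD_le ?absv1.
Qed.

Lemma ball_absv x y e : ball x e y = (absv (x - y) < e) :> Prop.
Proof. by rewrite ballEmdist. Qed.

Lemma cvg_absvP (T : Type) (F : set_system T) (FF : Filter F) (f : T -> K) l :
  (f @ F --> l)%classic <->
  forall e, 0 < e -> \forall t \near F, absv (l - f t) < e.
Proof.
rewrite cvg_ballP; split=> H e e0; have := H e e0;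
  by apply: filterS => t; rewrite ball_absv.
Qed.

Lemma lim_absv (T : Type) (F : set_system T) (FF : ProperFilter F)
    (f : T -> K) l :
  (forall e, 0 < e -> \forall t \near F, absv (l - f t) < e) ->
  (lim (f @ F))%classic = l.
Proof. by move/cvg_absvP; apply: cvg_lim; exact: metric_hausdorff. Qed.

Lemma closure_absvP (A : set K) x :
  closure A x <-> forall e, 0 < e -> exists2 y, A y & absv (x - y) < e.
Proof.
split=> [Ax e e0|H B].
  have [y [Ay]] := Ax _ (nbhsx_ballx x e e0).
  by rewrite ball_absv; exists y.
move/nbhs_ballP => [e /= e0 eB]; have [y Ay xy] := H e e0.
by exists y; split=> //; apply: eB; rewrite ball_absv.
Qed.

(** The cofactor of [q - 1] in [q ^+ n - 1] is a sum of powers of [q], each of absolute value 1,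
    hence is at most 1 in absolute value. *)
Lemma absv_expr1 q n : absv (q - 1) < 1 -> absv (q ^+ n - 1) <= absv (q - 1).
Proof.
move=> q1; rewrite subrX1 absvM ler_piMr ?absv_ge0 //.
apply: absv_sum_le => // i _.
by rewrite absvX absv_near1 1?absvC // expr1n.
Qed.

(** * Absolute values of natural numbers, and convergence of [q ^+ (p ^ N)] to 1 *)

Section Prime.
Variable p : nat.
Hypotheses (p_prime : prime p) (absv_p : absv (p%:R : K) = p%:R^-1).

Lemma invp_gt0 : 0 < p%:R^-1 :> R.
Proof. by rewrite invr_gt0 ltr0n prime_gt0. Qed.

Lemma invp_lt1 : p%:R^-1 < 1 :> R.
Proof. by rewrite invf_lt1 ?ltr0n ?prime_gt0 // ltr1n prime_gt1. Qed.

(** By Bezout some multiple [u * n] is 1 modulo [p], so it has absolute value 1; both factors being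
    at most 1, neither can be smaller. *)
Lemma absv_coprime_p n : coprime p n -> absv (n%:R : K) = 1.
Proof.
case: n => [|n] pn.
  by move: pn (prime_gt1 p_prime); rewrite /coprime gcdn0 => /eqP ->.
apply/eqP; rewrite eq_le absv_nat_le1 /=.
have [u v uE _] := egcdnP p (ltn0Sn n).
have E : absv (1 - (u * n.+1)%:R : K) < 1.
  rewrite uE gcdnC (eqP pn) natrD opprD addrCA subrr addr0.
  rewrite absvN natrM absvM absv_p.
  apply: le_lt_trans _ invp_lt1.
  by rewrite ler_piMl ?absv_nat_le1 // ltW // invp_gt0.
have := absv_near1 E; rewrite natrM absvM => uv.
by rewrite -[leLHS]uv ler_piMl ?absv_ge0 ?absv_nat_le1.
Qed.

Lemma absv_dvd_pX N n : (p ^ N %| n)%N -> absv (n%:R : K) <= p%:R^-1 ^+ N.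
Proof.
by case/dvdnP => c ->; rewrite natrM natrX absvM absvX absv_p ler_piMl ?absv_nat_le1.
Qed.

(** A number prime to [p] has absolute value 1, so [p] divides [n]; dividing by [p] lowers [N] by
    one. *)
Lemma absv_lt_pX N n : absv (n%:R : K) < p%:R^-1 ^+ N -> (p ^ N %| n)%N.
Proof.
elim: N n => [|N IH] n nlt; first exact: dvd1n.
have pn : (p %| n)%N.
  apply: contraLR nlt; rewrite -prime_coprime // => /absv_coprime_p ->.
  by rewrite -leNgt exprn_ile1 // ltW ?invp_gt0 ?invp_lt1.
case/dvdnP: pn nlt => c ->.
rewrite natrM absvM absv_p exprSr ltr_pM2r ?invp_gt0 // => /IH pNc.
by rewrite expnSr dvdn_mul.
Qed.

(** If [n] vanished in [K], every power of [p] would divide it, among them [p ^ n > n]. *)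
Lemma natr_neq0 n : (0 < n)%N -> (n%:R : K) != 0.
Proof.
move=> n0; apply/eqP => nK0.
have /dvdn_leq : (p ^ n %| n)%N.
  by apply: absv_lt_pX; rewrite nK0 absv0 exprn_gt0 // invp_gt0.
by move/(_ n0); rewrite leqNgt ltn_expl // prime_gt1.
Qed.

Lemma pX_small (e : R) : 0 < e -> exists N : nat, p%:R^-1 ^+ N < e.
Proof.
move=> e0; have [N] : exists N, `|p%:R^-1 ^+ N : R| < e.
  have := @cvg_expr R p%:R^-1.
  rewrite ger0_norm ?(ltW invp_gt0) // => /(_ invp_lt1)/cvgrPdist_lt/(_ e e0).
  by case=> N _ /(_ N (leqnn _)); rewrite sub0r normrN => H; exists N.
by rewrite ger0_norm ?exprn_ge0 ?(ltW invp_gt0) //; exists N.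
Qed.

(** Raising [w] to the power [p] multiplies its distance to 1 by at most [rho], the larger of [1/p]
    and [absv (q - 1)], so the distance decays geometrically. *)
Lemma exp_pX_near1 q e : absv (q - 1) < 1 -> 0 < e ->
  exists N : nat, absv (q ^+ (p ^ N) - 1) < e.
Proof.
move=> q1 e0; set rho := Num.max p%:R^-1 (absv (q - 1)).
have rho0 : 0 <= rho by rewrite le_max absv_ge0 orbT.
have rho1 : rho < 1 by rewrite gt_max invp_lt1.
have bound N : absv (q ^+ (p ^ N) - 1) <= rho ^+ N.
  elim: N => [|N IH]; first by rewrite expn0 expr1 expr0 ltW.
  set w := q ^+ (p ^ N) in IH *.
  have w1 : absv (w - 1) <= absv (q - 1) by exact: absv_expr1.
  have w11 := le_lt_trans w1 q1.
  rewrite expnSr exprM -/w subrX1 absvM exprSr.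
  apply: ler_pM; rewrite ?absv_ge0 //.
  (* The cofactor of [w - 1] in [w ^+ p - 1] is [p] plus terms no larger than [w - 1], hence bounded
     by [rho]. *)
  have -> : \sum_(i < p) w ^+ i = p%:R + \sum_(i < p) (w ^+ i - 1).
    by rewrite sumrB sumr_const card_ord addrC subrK.
  apply: absvD_le; first by rewrite absv_p le_max lexx.
  apply: absv_sum_le => // i _.
  by rewrite le_max (le_trans (absv_expr1 _ _) w1) ?orbT.
have := @cvg_expr R rho; rewrite ger0_norm // => /(_ rho1)/cvgrPdist_lt/(_ e e0).
case=> N _ /(_ N (leqnn _)); rewrite sub0r normrN ger0_norm ?exprn_ge0 // => H.
by exists N; apply: le_lt_trans (bound N) H.
Qed.

End Prime.
End Absv.

(** * [Z_p] as the closure of the natural numbers, and the power [q^x] *)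

Section Qpow.
Variables (R : realType) (K : ultrametricField R) (p : nat).
Hypotheses (p_prime : prime p) (absv_p : absv (p%:R : K) = p%:R^-1).
(* The closure of the natural numbers, i.e. Z_p: the points where the filter
   defining [qpow] is proper. *)
Definition natZp : set K := closure (range (fun n : nat => n%:R : K)).

Lemma natZpP (x : K) :
  natZp x <-> forall e, 0 < e -> exists n : nat, absv (x - n%:R) < e.
Proof.
split=> [/closure_absvP H e /H [_ [n _ <-]]|H]; first by exists n.
by apply/closure_absvP => e /H [n xn]; exists n%:R => //; exists n.
Qed.

Lemma natZp_nat (n : nat) : natZp n%:R.
Proof. by apply/natZpP => e e0; exists n; rewrite subrr absv0. Qed.

Lemma natZp0 : natZp 0.
Proof. by rewrite -(mulr0n 1); exact: natZp_nat. Qed.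

Lemma natZpD (x y : K) : natZp x -> natZp y -> natZp (x + y).
Proof.
move=> /natZpP xZ /natZpP yZ; apply/natZpP => e e0.
have [[n xn] [n' yn]] := (xZ _ e0, yZ _ e0).
by exists (n + n')%N; rewrite natrD opprD addrACA absvD_lt.
Qed.

Lemma natZpMn (x : K) (n : nat) : natZp x -> natZp (n%:R * x).
Proof.
move=> xZ; elim: n => [|n IH]; first by rewrite mul0r; exact: natZp0.
by rewrite -natr1 mulrDl mul1r; apply: natZpD.
Qed.

Lemma natZp_oppn (n : nat) : natZp (- n%:R).
Proof.
apply/natZpP => e e0; have [N Ne] := pX_small p_prime e0.
(* This natural number differs from [- n] by [p ^ N * n], which is small. *)
exists ((p ^ N).-1 * n)%N; apply: le_lt_trans Ne.
rewrite -opprD absvN -natrD -mulSn prednK ?expn_gt0 ?prime_gt0 //.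
by apply: absv_dvd_pX => //; apply: dvdn_mulr.
Qed.

Lemma absv_int (z : int) : absv (z%:~R : K) = absv (`|z|%N%:R : K).
Proof. by case: (intP z) => [//|n|n]; rewrite ?absvN // mulrNz absvN abszN. Qed.

Lemma natZpN (x : K) : natZp x -> natZp (- x).
Proof.
move=> /natZpP xZ; apply/natZpP => e e0; have [n xn] := xZ _ e0.
have /natZpP/(_ _ e0) [n' nn'] := @natZp_oppn n.
exists n'; apply: absvB_lt nn'.
by rewrite -opprD absvN.
Qed.

(** A Bezout inverse [u] of [n] modulo [p ^ N] approximates [1/n]: the error is [(1 - u n)/n], and
    [n] has absolute value 1. *)
Lemma natZp_inv (n : nat) : coprime p n -> natZp (n%:R^-1).
Proof.
move=> pn; apply/natZpP => e e0; have [N Ne] := pX_small p_prime e0.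
have n1 := absv_coprime_p p_prime absv_p pn.
have n0 : (0 < n)%N.
  by rewrite lt0n; apply: contra_eqN n1 => /eqP ->; rewrite absv0 eq_sym oner_eq0.
have nK0 : (n%:R : K) != 0 by rewrite -absv_eq0 n1 oner_eq0.
have [u v uE _] := egcdnP (p ^ N) n0.
exists u; apply: le_lt_trans Ne.
have -> : n%:R^-1 - u%:R = (1 - (u * n)%:R) / n%:R :> K.
  by rewrite natrM mulrBl mul1r mulfK.
rewrite absvM absvV n1 invr1 mulr1 uE gcdnC.
have /eqP -> : coprime (p ^ N) n by rewrite coprimeXl.
rewrite natrD opprD addrCA subrr addr0 absvN.
exact/absv_dvd_pX/dvdn_mull.
Qed.

(** In lowest terms, if [p] divided the denominator it would not divide the numerator, and the
    absolute value would exceed 1. So the denominator is prime to [p] and its inverse is a limit of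
    natural numbers. *)
Lemma ratr_natZp (r : rat) : absv (ratr r : K) <= 1 -> natZp (ratr r).
Proof.
rewrite /ratr absvM absvV !absv_int => r1.
have den_gt0 : (0 < `|denq r|)%N by rewrite absz_gt0 denq_neq0.
have den_unit : coprime p `|denq r|.
  rewrite prime_coprime //; apply/negP => pd.
  have pn : coprime p `|numq r|.
    rewrite prime_coprime //; apply/negP => pn.
    have := coprime_num_den r; rewrite /coprime => /eqP g1.
    have : (p %| 1)%N by rewrite -g1 dvdn_gcd pn.
    by rewrite dvdn1 => /eqP p1; move: p_prime; rewrite p1.
  rewrite (absv_coprime_p p_prime absv_p pn) mul1r in r1.
  have d1 : absv (`|denq r|%N%:R : K) <= p%:R^-1 ^+ 1 by apply: absv_dvd_pX; rewrite ?expn1.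
  rewrite expr1 in d1.
  have d0 : 0 < absv (`|denq r|%N%:R : K).
    by rewrite lt_neqAle absv_ge0 andbT eq_sym absv_eq0 (natr_neq0 p_prime absv_p).
  have : absv (`|denq r|%N%:R : K) < 1 by apply: le_lt_trans d1 (invp_lt1 R p_prime).
  by rewrite -invf_gt1 // ltNge r1.
have -> : (denq r)%:~R = `|denq r|%N%:R :> K.
  by rewrite -[in LHS](gtz0_abs (denq_gt0 r)).
have dZ := natZp_inv den_unit.
case: (intP (numq r)) => [|n|n]; first by rewrite mul0r; exact: natZp0.
  exact: natZpMn.
by rewrite mulrNz mulNr; apply: natZpN; apply: natZpMn.
Qed.

(** Links the two descriptions of [Z_p]. A rational at distance below 1 from [x] lies in the unit
    ball too, whence the minimum of [e] and 1. *)
Lemma padicZ_natZp (x : K) : padicZ x -> natZp x.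
Proof.
case=> /closure_absvP xQ x1; apply/natZpP => e e0.
have m0 : 0 < Num.min e 1 by rewrite lt_min e0 ltr01.
have [_ [r _ <-]] := xQ _ m0; rewrite lt_min => /andP[xr_e xr_1].
have r1 : absv (ratr r : K) <= 1.
  by rewrite -[ratr r](subKr x) absvD_le // absvN ltW.
have /natZpP/(_ _ e0) [n rn] := ratr_natZp r1.
by exists n; apply: absvB_lt xr_e rn.
Qed.

Variable q : K.
Hypothesis q_near1 : absv (1 - q) < 1.

Lemma absv_expr (n : nat) : absv (q ^+ n) = 1.
Proof. by rewrite absvX absv_near1 // expr1n. Qed.

(** Uniform continuity of [n |-> q ^+ n] for the p-adic distance: when [p ^ N0] divides [n - n'],
    the difference is a unit times a power of [q ^+ (p ^ N0)] minus 1. *)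
Lemma expr_uniform e : 0 < e -> exists2 c, 0 < c &
  forall n n' : nat, absv (n%:R - n'%:R : K) < c -> absv (q ^+ n - q ^+ n') < e.
Proof.
move=> e0; have q1 : absv (q - 1) < 1 by rewrite absvC.
have [N0 He] := exp_pX_near1 p_prime absv_p q1 e0.
exists (p%:R^-1 ^+ N0); first by rewrite exprn_gt0 // invp_gt0.
move=> n n'; wlog le_n : n n' / (n' <= n)%N => [W|].
  case/orP: (leq_total n' n) => le; first exact: W.
  by rewrite absvC [in X in _ -> X]absvC; apply: W.
rewrite -natrB // => /(absv_lt_pX p_prime absv_p) /dvdnP [c E].
rewrite -[in q ^+ n](subnK le_n) exprD -{2}[q ^+ n']mul1r -mulrBl.
rewrite absvM absv_expr mulr1 E mulnC exprM.
apply: le_lt_trans He; apply: absv_expr1.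
exact: le_lt_trans (absv_expr1 _ q1) q1.
Qed.

Let natF (y : K) : set_system nat :=
  filter_from (nbhs y) (preimage (fun n : nat => n%:R : K)).

Let natF_filter y : natZp y -> ProperFilter (natF y).
Proof.
move=> /natZpP yZ; apply: filter_from_proper.
  apply: filter_from_filter => [|A B Ay By]; first by exists setT; apply: filterT.
  by exists (A `&` B)%classic => //; apply: filterI.
move=> A /nbhs_ballP [e /= e0 eA]; have [n yn] := yZ _ e0.
by exists n; apply: eA; rewrite ball_absv.
Qed.

Let natF_near y (e : R) (P : nat -> Prop) : 0 < e ->
  (forall n, absv (y - n%:R) < e -> P n) -> natF y P.
Proof.
move=> e0 H; exists (ball y e); first exact: nbhsx_ballx.
by move=> n /=; rewrite ball_absv; apply: H.
Qed.

Lemma qpow_eq (y L : K) : natZp y ->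
  (forall e, 0 < e -> exists2 c, 0 < c &
     forall n : nat, absv (y - n%:R) < c -> absv (L - q ^+ n) < e) ->
  qpow q y = L.
Proof.
move=> yZ H; have FF := natF_filter yZ; apply: lim_absv => e e0.
have [c c0 Hc] := H e e0; exact: natF_near c0 Hc.
Qed.

Hypothesis K_complete :
  forall F : set_system K, ProperFilter F -> cauchy F -> cvg F.

(** Existence of the limit defining [q^y]: by uniform continuity the powers form a Cauchy filter,
    which converges by completeness. *)
Lemma qpow_near (y : K) : natZp y ->
  forall e, 0 < e -> exists2 c, 0 < c &
     forall n : nat, absv (y - n%:R) < c -> absv (qpow q y - q ^+ n) < e.
Proof.
move=> yZ e e0; have FF := natF_filter yZ.
have : cvg ((fun n => q ^+ n) @ natF y)%classic.
  apply: K_complete; apply: cauchy_exP => eps eps0.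
  have [c c0 Hc] := expr_uniform eps0.
  have /natZpP/(_ c c0) [n yn] := yZ.
  exists (q ^+ n); apply: (natF_near c0) => // n' yn'.
  rewrite /= ball_absv; apply: Hc; apply: absvB_lt yn'; by rewrite absvC.
move/cvg_absvP => /(_ e e0); rewrite -/(qpow q y) => -[B /nbhs_ballP [c /= c0 cB] Be].
by exists c => // n yn; apply: Be; apply: cB; rewrite ball_absv.
Qed.

Lemma qpow_nat (n : nat) : qpow q n%:R = q ^+ n.
Proof.
apply: qpow_eq => [|e /expr_uniform [c c0 Hc]]; first exact: natZp_nat.
by exists c => // n'; apply: Hc.
Qed.

Lemma absv_qpow_le1 (y : K) : natZp y -> absv (qpow q y) <= 1.
Proof.
move=> yZ; have [c c0 Hc] := qpow_near yZ ltr01.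
have /natZpP/(_ c c0) [n /Hc/ltW H] := yZ.
by rewrite -(subrK (q ^+ n) (qpow q y)) absvD_le ?absv_expr.
Qed.

Lemma qpowD (y z : K) : natZp y -> natZp z ->
  qpow q (y + z) = qpow q y * qpow q z.
Proof.
move=> yZ zZ; apply: qpow_eq => [|e e0]; first exact: natZpD.
have [c1 c10 H1] := qpow_near yZ e0.
have [c2 c20 H2] := qpow_near zZ e0.
have [c c0 Hc] := expr_uniform e0.
exists c => // n yzn.
(* The bound [c1] makes [q ^+ a] close to [q^y]; the bound [c] makes [a + b] close enough to [n] for
   [q ^+ (a + b)] to be close to [q ^+ n]. *)
have /natZpP/(_ (Num.min c c1)) [|a] := yZ; first by rewrite lt_min c0.
rewrite lt_min => /andP[ya_c ya].
have /natZpP/(_ (Num.min c c2)) [|b] := zZ; first by rewrite lt_min c0.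
rewrite lt_min => /andP[zb_c zb].
apply: (@absvB_lt _ _ _ (q ^+ (a + b))).
  rewrite exprD.
  have -> : qpow q y * qpow q z - q ^+ a * q ^+ b =
     qpow q y * (qpow q z - q ^+ b) + (qpow q y - q ^+ a) * q ^+ b by ring.
  apply: absvD_lt; rewrite absvM ?absv_expr ?mulr1; last exact: H1.
  by apply: le_lt_trans (H2 _ zb); rewrite ler_piMl ?absv_ge0 ?absv_qpow_le1.
apply: Hc; apply: absvB_lt yzn; rewrite absvC natrD opprD addrACA.
exact: absvD_lt.
Qed.

Lemma qpow0 : qpow q 0 = 1.
Proof. by rewrite -(mulr0n 1) qpow_nat expr0. Qed.

Lemma qpow_int (z : int) : qpow q z%:~R = q ^ z.
Proof.
have qn0 n : q ^+ n != 0 by rewrite -absv_eq0 absv_expr oner_eq0.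
case: z => n; first exact: qpow_nat.
rewrite NegzE mulrNz -exprnN; apply: (mulfI (qn0 n.+1)).
rewrite -[X in X * _]qpow_nat -qpowD ?subrr ?qpow0 ?mulfV //.
  exact: natZp_nat.
exact: natZp_oppn.
Qed.

Lemma qpowMn (y : K) (n : nat) : natZp y -> qpow q (n%:R * y) = qpow q y ^+ n.
Proof.
move=> yZ; elim: n => [|n IH]; first by rewrite mul0r qpow0.
by rewrite -natr1 mulrDl mul1r qpowD ?IH ?exprSr //; apply: natZpMn.
Qed.

End Qpow.

(** * Linearity of limits in [K] *)

Section CvgAbsv.
Variables (R : realType) (K : ultrametricField R).
Variables (T : Type) (F : set_system T).
Context {FF : Filter F}.
Implicit Types (u v : T -> K) (c l : K).
Local Open Scope classical_set_scope.

Lemma cvg_absvD u v (l l' : K) :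
  u @ F --> l -> v @ F --> l' -> (fun t => u t + v t) @ F --> l + l'.
Proof.
move=> /cvg_absvP ul /cvg_absvP vl; apply/cvg_absvP => e e0.
apply: filterS2 (ul e e0) (vl e e0) => t ut vt.
by rewrite opprD addrACA absvD_lt.
Qed.

Lemma cvg_absvZ c u l : u @ F --> l -> (fun t => c * u t) @ F --> c * l.
Proof.
move=> /cvg_absvP ul; apply/cvg_absvP => e e0.
(* Adding 1 keeps the divisor positive when [c] is 0. *)
have c0 : 0 < absv c + 1 by rewrite ltr_wpDl ?absv_ge0.
have := ul (e / (absv c + 1)); rewrite divr_gt0 // => /(_ isT).
apply: filterS => t; rewrite ltr_pdivlMr // mulrC => H.
rewrite -mulrBr absvM; apply: le_lt_trans H.
by rewrite ler_wpM2r ?absv_ge0 // lerDl.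
Qed.

Lemma cvg_absv_sum (I : Type) (r : seq I) (u : I -> T -> K) (l : I -> K) :
  (forall i, u i @ F --> l i) ->
  (fun t => \sum_(i <- r) u i t) @ F --> \sum_(i <- r) l i.
Proof.
move=> ul; elim: r => [|i r IH].
  rewrite big_nil; apply/cvg_absvP => e e0; near=> t.
  by rewrite big_nil subrr absv0.
rewrite big_cons.
under eq_fun => t do rewrite big_cons.
exact: cvg_absvD.
Unshelve. all: by end_near.
Qed.

End CvgAbsv.

Lemma sum_nat_blocks (K : comNzRingType) (d : nat) (F : nat -> K) (z : K) :
  (forall b a : nat, F (d * b + a)%N = F a * z ^+ b) ->
  forall M : nat, \sum_(0 <= j < d * M) F j
    = (\sum_(a < d) F a) * \sum_(b < M) z ^+ b.
Proof.
move=> FE; elim=> [|M IH]; first by rewrite muln0 big_geq // big_ord0 mulr0.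
rewrite mulnS addnC (@big_cat_nat _ _ _ (d * M)) ?leq_addr //= IH.
rewrite big_ord_recr mulrDr; congr (_ + _).
rewrite -{1}[(d * M)%N]add0n big_addn addnC addnK big_mkord mulr_suml.
by apply: eq_bigr => a _; rewrite addnC FE.
Qed.

(** * Integrals of combinations of [chi(y) q^(e y)] in one and several variables *)

Section Integral.
Variables (R : realType) (K : ultrametricField R) (p d : nat).
Hypotheses (p_prime : prime p) (p_odd : odd p) (d_odd : odd d).
Hypothesis absv_p : absv (p%:R : K) = p%:R^-1.
Variables (chi : int -> K) (q : K).
Hypothesis chi_mod : forall a b, (a = b %[mod d])%Z -> chi a = chi b.
Hypothesis q_near1 : absv (1 - q) < 1.

Lemma toZp_nat (j : nat) : toZp K (dpLim_nat d p j) = j%:R.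
Proof.
(* From [N = j] on, [j <= N < p ^ N <= d * p ^ N], so the residue of [j] is [j] itself. *)
apply: lim_absv => e e0; exists j => // N /= jN.
rewrite modn_small ?subrr ?absv0 //.
apply: leq_ltn_trans jN _; apply: leq_trans (ltn_expl N (prime_gt1 p_prime)) _.
by rewrite leq_pmull // odd_gt0.
Qed.

Lemma char_lim_nat (j : nat) : char_lim chi (dpLim_nat d p j) = chi j%:Z.
Proof.
rewrite /char_lim /= expn0 muln1; apply: chi_mod.
by rewrite -modz_nat modz_mod.
Qed.

Lemma q_neq0 : q != 0.
Proof. by rewrite -absv_eq0 absv_near1 // oner_eq0. Qed.

Lemma absv_exprz_near1 (z : int) : absv (q ^ z - 1) < 1.
Proof.
have q1 : absv (q - 1) < 1 by rewrite absvC.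
case: (intP z) => [|n|n]; first by rewrite expr0z subrr absv0.
  exact: le_lt_trans (absv_expr1 _ q1) q1.
have qn0 : q ^+ n.+1 != 0 by rewrite expf_neq0 ?q_neq0.
have -> : q ^ (- n.+1%:Z) - 1 = (1 - q ^+ n.+1) / q ^+ n.+1.
  by rewrite -exprnN mulrBl mulfV // mul1r.
rewrite absvM absvV absvX (absv_near1 q_near1) expr1n invr1 mulr1 absvC.
exact: le_lt_trans (absv_expr1 _ q1) q1.
Qed.

(** Otherwise [q ^ z - 1 = -2], of absolute value 1 because [p] is odd. *)
Lemma one_plus_neq0 (z : int) : 1 + q ^ z != 0.
Proof.
apply/eqP => E; have := absv_exprz_near1 z.
have -> : q ^ z - 1 = - 2%:R by rewrite -[q ^ z](addKr 1) E; ring.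
by rewrite absvN (absv_coprime_p p_prime absv_p) ?ltxx // coprimen2.
Qed.

(** Closed form of the integral of [chi(y) q^(e y)]. *)
Definition charInt (e : int) : K :=
  2 / (1 + q ^ (e * d%:Z))
  * \sum_(a < d) chi (a : nat)%:Z * q ^ (e * (a : nat)%:Z) * (-1) ^+ a.

Lemma charInt_cvg (e : int) :
  ((fun N => \sum_(0 <= j < d * p ^ N) chi j%:Z * q ^ (e * j%:Z) * (-1) ^+ j)
     @ \oo --> charInt e)%classic.
Proof.
rewrite /charInt; set Q := q ^ (e * d%:Z); set S := \sum_(a < d) _.
have Q1 : 1 + Q != 0 by exact: one_plus_neq0.
have partialE N : \sum_(0 <= j < d * p ^ N) chi j%:Z * q ^ (e * j%:Z) * (-1) ^+ j
    = S / (1 + Q) * (1 + Q ^+ (p ^ N)).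
  (* Shifting the index by [d] multiplies a term by [- Q]: [chi] has period [d], and the sign
     changes because [d] is odd. *)
  rewrite (@sum_nat_blocks _ d _ (- Q)) => [|b a].
    rewrite -/S -mulrA; congr (_ * _); apply: (mulfI Q1).
    (* Negation brings the geometric sum of ratio [- Q] to the form of [subrX1]; as [p ^ N] is odd,
       [(- Q) ^+ (p ^ N)] is [- Q ^+ (p ^ N)]. *)
    rewrite mulrA mulfV // mul1r; apply: oppr_inj.
    rewrite -mulNr opprD addrC addrC.
    have -> : - 1 - Q = - Q - 1 by ring.
    rewrite -subrX1 exprNn -signr_odd oddX p_odd orbT expr1; ring.
  have -> : chi (d * b + a)%N%:Z = chi a%:Z.
    by apply: chi_mod; rewrite PoszD PoszM mulrC modzMDl.
  rewrite PoszD PoszM mulrDr expfzDr ?q_neq0 // mulrA -exprz_exp.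
  rewrite exprD exprM -(signr_odd _ d) d_odd expr1 -/Q [(- Q) ^+ b]exprNn.
  by rewrite -exprnP; ring.
under eq_fun => N do rewrite partialE.
(* The factor 2 is the limit of [1 + Q ^+ (p ^ N)]. *)
have -> : 2 / (1 + Q) * S = S / (1 + Q) * (1 + 1) by field.
apply: cvg_absvZ; apply/cvg_absvP => eps eps0.
have Qn1 : absv (Q - 1) < 1 by exact: absv_exprz_near1.
have [N0 HN] := exp_pX_near1 p_prime absv_p Qn1 eps0.
exists N0 => // N /= leN.
rewrite opprD addrACA subrr add0r absvC.
apply: le_lt_trans HN; rewrite -(subnKC leN) expnD exprM.
apply: absv_expr1; exact: le_lt_trans (absv_expr1 _ Qn1) Qn1.
Qed.

Lemma fint_charE (n : nat) (c : 'I_n -> K) (e : 'I_n -> int)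
    (f : dpLim d p -> K) :
  (forall j : nat, f (dpLim_nat d p j)
     = \sum_(s < n) c s * (chi j%:Z * q ^ (e s * j%:Z))) ->
  fint f = \sum_(s < n) c s * charInt (e s).
Proof.
move=> fE; apply: cvg_lim; first exact: metric_hausdorff.
have -> : (fun N => \sum_(0 <= j < d * p ^ N) f (dpLim_nat d p j) * (-1) ^+ j)
  = (fun N => \sum_(s < n) c s *
      \sum_(0 <= j < d * p ^ N) chi j%:Z * q ^ (e s * j%:Z) * (-1) ^+ j).
  apply/funext => N.
  under [RHS]eq_bigr => s _ do rewrite mulr_sumr.
  rewrite exchange_big /=; apply: eq_bigr => j _.
  by rewrite fE mulr_suml; apply: eq_bigr => s _; rewrite -!mulrA.
by apply: cvg_absv_sum => s; apply: cvg_absvZ; exact: charInt_cvg.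
Qed.

(** The integrals see [f] only at tuples of natural numbers, so the formula for [f] is assumed there
    only. Each term separates the variables and integrates to a product. *)
Lemma fintn_charE (n k : nat) (c : 'I_n -> K) (e : 'I_n -> nat -> int)
    (f : k.-tuple (dpLim d p) -> K) :
  (forall u : k.-tuple nat, f (map_tuple (dpLim_nat d p) u)
     = \sum_(s < n) c s *
         \prod_(i < k) (chi (tnth u i)%:Z * q ^ (e s i * (tnth u i)%:Z))) ->
  fintn f = \sum_(s < n) c s * \prod_(i < k) charInt (e s i).
Proof.
elim: k c f => [|k IH] c f fE.
  rewrite /= (_ : [tuple] = map_tuple (dpLim_nat d p) [tuple]); last exact: val_inj.
  by rewrite fE; apply: eq_bigr => s _; rewrite !big_ord0.
(* The outer integral is over the last variable, of index [k]. For a natural value [j] of it, the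
   induction hypothesis gives the inner integral, the factor in [j] being absorbed into the
   coefficients. *)
rewrite /= (@fint_charE n (fun s => c s * \prod_(i < k) charInt (e s i))
   (fun s => e s k)) => [|j].
  by apply: eq_bigr => s _; rewrite big_ord_recr /= mulrA.
rewrite (IH (fun s => c s * (chi j%:Z * q ^ (e s k * j%:Z)))) => [|u].
  by apply: eq_bigr => s _; rewrite mulrAC.
have -> : [tuple of rcons (map_tuple (dpLim_nat d p) u) (dpLim_nat d p j)]
    = map_tuple (dpLim_nat d p) [tuple of rcons u j].
  by apply: val_inj; rewrite /= map_rcons.
rewrite fE; apply: eq_bigr => s _; rewrite big_ord_recr /= mulrA mulrAC.
rewrite (tnth_nth 0%N) /= nth_rcons size_tuple ltnn eqxx; congr (_ * _ * _).
by apply: eq_bigr => i _; rewrite !(tnth_nth 0%N) /= nth_rcons size_tuple ltn_ord.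
Qed.

(* The iterated integral of [q ^ (\sum_i (s - i) x_i) * \prod_i chi x_i],
   [1 <= i <= k], i.e. of the weight of [qEuler] times
   [(q ^ (\sum_i x_i)) ^+ s]. *)
Definition charMoment (k : nat) (s : nat) : K :=
  \prod_(i < k) charInt (s%:Z - i.+1%:Z).

(** The monomial of degree [s] in [q ^+ (\sum_i u_i)] turns each weight exponent [-(i+1)] into
    [s - (i+1)], so it integrates to the moment of index [s]. *)
Lemma fintn_polyE (n k : nat) (P : {poly K}) (f : k.-tuple (dpLim d p) -> K) :
  (size P <= n)%N ->
  (forall u : k.-tuple nat, f (map_tuple (dpLim_nat d p) u)
     = (\prod_(i < k) (chi (tnth u i)%:Z * q ^ (- i.+1%:Z * (tnth u i)%:Z)))
       * P.[q ^+ (\sum_(i < k) tnth u i)]) ->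
  fintn f = \sum_(s < n) P`_s * charMoment k s.
Proof.
move=> sP fE.
apply: (@fintn_charE n k (fun s => P`_s)
  (fun (s : 'I_n) i => (s : nat)%:Z - i.+1%:Z)) => u.
rewrite fE (horner_coef_wide _ sP) mulr_sumr; apply: eq_bigr => s _.
rewrite mulrCA; congr (_ * _).
rewrite -exprM mulnC exprM expr_sum -big_split; apply: eq_bigr => i _ /=.
rewrite -mulrA; congr (_ * _).
rewrite mulrDl expfzDr ?q_neq0 // mulrC; congr (_ * _).
by rewrite -exprM -PoszM.
Qed.

End Integral.

(** * The q-Euler polynomials through moments, and their binomial sum *)

Section QEuler.
Variables (R : realType) (K : ultrametricField R) (p d : nat).
Hypotheses (p_prime : prime p) (p_odd : odd p) (d_odd : odd d).
Hypothesis K_Cp : is_Cp K p.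
Variables (chi : int -> K) (q : K).
Hypothesis chi_mod : forall a b, (a = b %[mod d])%Z -> chi a = chi b.
Hypothesis q_near1 : absv (1 - q) < 1.

Let absv_p : absv (p%:R : K) = p%:R^-1 := Cp_normp K_Cp.
Let K_complete := Cp_complete K_Cp.

(* For [q != 1], [[x + u]_q] is the value of this polynomial at [q ^ u]. *)
Definition qnum_poly (x : K) : {poly K} :=
  (1 - q)^-1 *: (1 - qpow q x *: 'X).

Lemma size_qnum_poly_exp (x : K) (l : nat) :
  (size (qnum_poly x ^+ l)%R <= l.+1)%N.
Proof.
apply: leq_trans (size_poly_exp_leq _ _) _.
rewrite ltnS -[leqRHS]mul1n leq_mul2r; apply/orP; right.
rewrite -subn1 leq_subLR.
apply: leq_trans (size_scale_leq _ _) _.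
apply: leq_trans (size_polyD _ _) _.
rewrite geq_max size_poly1 size_polyN /=.
by apply: leq_trans (size_scale_leq _ _) _; rewrite size_polyX.
Qed.

Lemma qEuler_weight (k : nat) (u : k.-tuple nat) :
  qpow q (\sum_(i < k) (0 - i.+1%:Z)%:~R * toZp K (tnth (map_tuple (dpLim_nat d p) u) i))
    * (\prod_(i < k) char_lim chi (tnth (map_tuple (dpLim_nat d p) u) i))
  = \prod_(i < k) (chi (tnth u i)%:Z * q ^ (- i.+1%:Z * (tnth u i)%:Z)).
Proof.
under eq_bigr => i _ do
  rewrite tnth_map toZp_nat // sub0r -[_%:R]/((tnth u i)%:Z%:~R) -intrM.
rewrite -rmorph_sum /= (qpow_int p_prime absv_p q_near1 K_complete).
under [X in _ * X]eq_bigr => i _ do rewrite tnth_map char_lim_nat //.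
rewrite mulrC big_split; congr (_ * _) => /=.
elim/big_rec2: _ => [|i y z _ <-]; first exact: expr0z.
by rewrite expfzDr ?q_neq0.
Qed.

Lemma qnum_shift (x : K) (u : nat) : q != 1 -> natZp x ->
  qnum q (x + u%:R) = (qnum_poly x).[q ^+ u].
Proof.
move=> q1 xZ; rewrite /qnum (negbTE q1).
rewrite (qpowD p_prime absv_p q_near1 K_complete xZ (@natZp_nat _ _ u)).
rewrite (qpow_nat p_prime absv_p q_near1).
by rewrite !hornerE mulrC.
Qed.

(** The free length [n] lets all [l <= m] share one range of [s], so that the two sums can later be
    exchanged. *)
Lemma qEuler_moments (n k l : nat) (x : K) : q != 1 -> natZp x -> (l < n)%N ->
  qEuler d p chi q 0 k l x
  = \sum_(s < n) (qnum_poly x ^+ l)`_s * charMoment d chi q k s.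
Proof.
move=> q1 xZ ln; apply: (fintn_polyE p_prime p_odd d_odd absv_p chi_mod q_near1).
  exact: leq_trans (size_qnum_poly_exp _ _) _.
move=> u; rewrite qEuler_weight; congr (_ * _).
under eq_bigr => i _ do rewrite tnth_map toZp_nat //.
by rewrite -natr_sum qnum_shift // horner_exp.
Qed.

(** For [q != 1], [1 + (q - 1) qnum_poly x] is the monomial [q^x X]. The binomial sum of the powers
    of [qnum_poly x] is therefore [(q^x X)^m], and only the moment of index [m] survives. *)
Lemma qEuler_sum (k m : nat) (x : K) : natZp x ->
  \sum_(0 <= l < m.+1) 'C(m, l)%:R * (q - 1) ^+ l * qEuler d p chi q 0 k l x
  = qpow q x ^+ m * charMoment d chi q k m.
Proof.
move=> xZ; rewrite big_mkord; have [q1|q1] := eqVneq q 1.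
  (* Only the term [l = 0] survives, and the moments do not depend on [s]. *)
  have qx1 : qpow q x = 1.
    apply: (qpow_eq xZ) => e e0; exists 1; first exact: ltr01.
    by move=> n _; rewrite q1 expr1n subrr absv0.
  have charE s : charMoment d chi q k s = charMoment d chi q k 0.
    apply: eq_bigr => i _; rewrite /charInt q1 !exp1rz.
    by congr (_ * _); apply: eq_bigr => a _; rewrite !exp1rz.
  rewrite big_ord_recl big1 => [|l _]; last first.
    by rewrite q1 subrr expr0n mulr0 mul0r.
  rewrite bin0 expr0 !mul1r addr0 qx1 expr1n mul1r charE.
  rewrite /qEuler.
  (* For [l = 0] the bracket is raised to the power 0, so the polynomial is the constant 1. *)
  rewrite (fintn_polyE p_prime p_odd d_odd absv_p chi_mod q_near1
    (n := 1) (P := 1)) ?size_poly1 // => [|u].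
    by rewrite big_ord1 coef1 mul1r.
  by rewrite qEuler_weight; congr (_ * _); rewrite expr0 hornerE.
under eq_bigr => l _.
  rewrite (qEuler_moments k q1 xZ (ltn_ord l)) mulr_sumr.
  under eq_bigr => s _ do rewrite mulrA.
  over.
rewrite exchange_big /=.
under eq_bigr => s _ do rewrite -mulr_suml.
have coefE (s : nat) : \sum_(l < m.+1) 'C(m, l)%:R * (q - 1) ^+ l * (qnum_poly x ^+ l)`_s
   = ((qpow q x *: 'X) ^+ m)`_s.
  have -> : qpow q x *: 'X = 1 + (q - 1) *: qnum_poly x :> {poly K}.
    rewrite scalerA -(opprB 1 q) mulNr mulfV ?subr_eq0 1?eq_sym //.
    by rewrite scaleN1r opprB addrC subrK.
  rewrite exprDn coef_sum; apply: eq_bigr => l _.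
  by rewrite expr1n mul1r coefMn [in RHS]exprZn coefZ -[RHS]mulr_natl mulrA.
rewrite (bigD1 ord_max) //= coefE exprZn coefZ coefXn eqxx mulr1.
rewrite big1 ?addr0 // => s; rewrite -val_eqE => /negbTE /= sm.
by rewrite coefE exprZn coefZ coefXn sm mulr0 mul0r.
Qed.

(** Expanding the product of the [k] sums in [charInt] gives the sum over all [a]; the denominators
    [1 + q^(d(m-j))] are the factors of the Pochhammer symbol. *)
Lemma charMoment_quotient (k m : nat) :
  2 ^+ k * (\sum_(a : {ffun 'I_k -> 'I_d})
         (\prod_(j < k) chi (a j : nat)%:Z)
         * q ^ (\sum_(j < k) (m%:Z - j.+1%:Z) * (a j : nat)%:Z)
         * (-1) ^+ (\sum_(j < k) a j)%N)
    / qpoch (- q ^ (d%:Z * (m%:Z - k%:Z))) (q ^+ d) k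
  = charMoment d chi q k m.
Proof.
have q0 : q != 0 by exact: q_neq0.
rewrite /charMoment big_split /= bigA_distr_bigA big_split /=.
rewrite prodr_const card_ord [RHS]mulrAC -prodfV; congr (_ * _ * _).
  apply: eq_bigr => a _; rewrite !big_split /= expr_sum; congr (_ * _ * _).
  elim/big_rec2: _ => [|i y z _ <-]; first exact: expr0z.
  by rewrite expfzDr.
(* The Pochhammer exponents increase from [d(m-k)] while those of the moment decrease from [d(m-1)],
   so one product is read backwards. *)
rewrite (reindex_inj rev_ord_inj); apply: eq_bigr => i _ /=.
rewrite mulNr opprK -exprM exprnP -expfzDr //; congr (1 + q ^ _)^-1.
rewrite PoszM -subzn ?ltn_ord //; ring.
Qed.

End QEuler.

Theorem theorem3 (R : realType) (K : ultrametricField R) (p d k : nat)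
    (chi : int -> K) (q : K) (m : nat) (x : K)
    (p_prime : prime p) (p_odd : odd p) (K_Cp : is_Cp K p)
    (d_odd : odd d) (pd_coprime : coprime p d)
    (chi_prim : primitive_char d chi)
    (q_near1 : absv (1 - q) < 1) (x_Zp : padicZ x) :
  2 ^+ k * qpow q (m%:R * x)
    * (\sum_(a : {ffun 'I_k -> 'I_d})
         (\prod_(j < k) chi (a j : nat)%:Z)
         * q ^ (\sum_(j < k) (m%:Z - j.+1%:Z) * (a j : nat)%:Z)
         * (-1) ^+ (\sum_(j < k) a j)%N)
    / qpoch (- q ^ (d%:Z * (m%:Z - k%:Z))) (q ^+ d) k
  = \sum_(0 <= l < m.+1)
      'C(m, l)%:R * (q - 1) ^+ l * qEuler d p chi q 0 k l x.
Proof.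
have [[_ _ chi_mod _] _] := chi_prim.
have [absv_p K_complete _ _] := K_Cp.
have xZ : natZp x by exact: (padicZ_natZp p_prime absv_p x_Zp).
rewrite (qEuler_sum p_prime p_odd d_odd K_Cp chi_mod q_near1 k m xZ).
rewrite (qpowMn p_prime absv_p q_near1 K_complete m xZ).
by rewrite -charMoment_quotient // -!mulrA mulrCA.
Qed.
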